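(* For any fixed graph $T$ with $t$ vertices and $q$ edges and any $m$ there is a constant $c=c(t,q,m)\le(m-1)2^{(m-2)/2}(qt)^m$ such that for any $n$ divisible by $t$ and any partition $P$ of the edges of the complete graph $K_n$ into $m$ subsets, there is a $T$-factor $H$ in $K_n$ such that $$\Big\|x(H,P)-\frac{2q}{(n-1)t}x(K_n,P)\Big\|_\infty\le\Big\|x(H,P)-\frac{2q}{(n-1)t}x(K_n,P)\Big\|_2\le c.$$
   Context: For a graph $T$ with $t$ vertices, where $t$ divides $n$, a $T$-factor in $K_n$ is a subgraph consisting of $n/t$ pairwise vertex-disjoint copies of $T$. For a graph $G$ whose edge set is partitioned by $P$ into classes $E_1,\dots,E_m$ and a subgraph $H'=(V',E')$ of $G$, $x(H',P)=(x_1,\dots,x_m)$ with $x_i=|E_i\cap E'|$. *)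

(* Defs.v *)
From HB Require Import structures.
From mathcomp Require Import all_boot all_order all_algebra.
From mathcomp Require Import reals normedtype exp.
Import Order.TTheory GRing.Theory Num.Theory.
Import numFieldNormedType.Exports.

Set Implicit Arguments.
Unset Strict Implicit.
Unset Printing Implicit Defensive.

Local Open Scope ring_scope.

Record graph := Graph {
  vertex :> finType;
  edges : {set {set vertex}};
  card_edge : forall e, e \in edges -> #|e| = 2%N
}.

Record subgraph (G : graph) := Subgraph {
  sub_vertices : {set G};
  sub_edges : {set {set G}};
  sub_edgesS : sub_edges \subset edges G;
  sub_edges_ends : forall e, e \in sub_edges -> e \subset sub_vertices
}.

Section Complete.
Variable n : nat.

Definition complete_edges : {set {set 'I_n}} :=
  [set e : {set 'I_n} | #|e| == 2%N].

Lemma complete_card_edge e : e \in complete_edges -> #|e| = 2%N.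
Proof. by rewrite inE => /eqP. Qed.

Definition complete : graph := Graph complete_card_edge.
End Complete.

Section Full.
Variable G : graph.

Lemma full_ends (e : {set G}) : e \in edges G -> e \subset [set: G].
Proof. by move=> _; apply: subsetT. Qed.

Definition full : subgraph G := Subgraph (subxx (edges G)) full_ends.
End Full.

(* The copy need not be induced: [H] is the image of [T] under an injection of
   the vertices, and has no other edges. *)
Definition is_copy (T G : graph) (H : subgraph G) : Prop :=
  exists f : T -> G,
    [/\ injective f,
        sub_vertices H = f @: [set: T] &
        sub_edges H = [set f @: (e : {set T}) | e in edges T]].

Definition is_factor (T : graph) (n : nat) (H : subgraph (complete n)) : Prop :=
  exists C : 'I_(n %/ #|T|) -> subgraph (complete n),
    [/\ forall i, is_copy T (C i),
        forall i j, i != j -> [disjoint sub_vertices (C i) & sub_vertices (C j)],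
        sub_vertices H = \bigcup_i sub_vertices (C i) &
        sub_edges H = \bigcup_i sub_edges (C i)].

(* The classes may be empty, so this is not [finset.partition]. *)
Definition edge_partition (G : graph) (m : nat) (P : 'I_m -> {set {set G}}) :
    Prop :=
  (forall i j, i != j -> [disjoint P i & P j]) /\ \bigcup_i P i = edges G.

Definition count_vec (R : realType) (G : graph) (m : nat) (H : subgraph G)
    (P : 'I_m -> {set {set G}}) : 'rV[R]_m :=
  \row_i #|P i :&: sub_edges H|%:R.

(* The library norm [`|x|] on row vectors is the maximum norm. *)
Definition norm2 (R : realType) (m : nat) (x : 'rV[R]_m) : R :=
  Num.sqrt (\sum_i x 0 i ^+ 2).

(* Main.v *)
Require Import Defs.
From HB Require Import structures.
From mathcomp Require Import all_boot all_order all_algebra.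
From mathcomp Require Import fingroup perm ring lra.
From mathcomp Require Import reals normedtype exp.
Import Order.TTheory GRing.Theory Num.Theory.
Import numFieldNormedType.Exports.

Set Implicit Arguments.
Unset Strict Implicit.
Unset Printing Implicit Defensive.

Local Open Scope ring_scope.

(* Write s = q t, and choose a factor H whose deviation d from the mean vector
   has least Euclidean norm.  Two kinds of moves change H locally: embed T
   anew on the vertices of one of its copies, or replace t of its copies by t
   copies each meeting every old one in a single vertex.  Weighted suitably,
   the moves hit all pairs of vertices equally often, so a nonnegative
   combination of the changes y of the count vector is a negative multiple of
   d.  At most s edges are removed and at most s are added, so |y|^2 <= 2 s^2,
   and minimality of |d| gives <y, d> >= - s^2.

   By Caratheodory -d is a nonnegative combination of linearly independent
   changes y_j; there are at most m - 1 of them, since their entries sum to 0.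
   The y_j are integral, so their Gram determinant is at least 1, and with
   Hadamard's inequality each coefficient is at most |d| (2 s^2)^((m-2)/2).
   Pairing with d yields |d|^2 <= (m-1) s^2 |d| (2 s^2)^((m-2)/2).

   Transversal moves need t copies; when n / t < t the trivial bound
   |d|^2 <= 2 (q n / t)^2 suffices. *)

(** * Gram determinants and conic combinations *)

Section Gram.
Variables (R : archiRealFieldType) (m : nat).
Implicit Types (u v : 'rV[R]_m).

Definition dot u v : R := \sum_k u 0 k * v 0 k.

Definition gram k (Y : 'M[R]_(k, m)) : R := \det (Y *m Y^T).

Lemma dotE u v : u *m v^T = (dot u v)%:M.
Proof.
rewrite [LHS]mx11_scalar mxE; congr _%:M.
by apply: eq_bigr => k _; rewrite mxE.
Qed.

Lemma dotC u v : dot u v = dot v u.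
Proof. by apply: eq_bigr => k _; rewrite mulrC. Qed.

Lemma dotDl u u' v : dot (u + u') v = dot u v + dot u' v.
Proof. by rewrite -big_split; apply: eq_bigr => k _; rewrite mxE mulrDl. Qed.

Lemma dotZl a u v : dot (a *: u) v = a * dot u v.
Proof. by rewrite mulr_sumr; apply: eq_bigr => k _; rewrite mxE mulrA. Qed.

Lemma dotDr u v v' : dot u (v + v') = dot u v + dot u v'.
Proof. by rewrite dotC dotDl !(dotC _ u). Qed.

Lemma dotZr a u v : dot u (a *: v) = a * dot u v.
Proof. by rewrite dotC dotZl (dotC _ u). Qed.

Lemma dot_sumr (I : finType) u (F : I -> 'rV[R]_m) :
  dot u (\sum_i F i) = \sum_i dot u (F i).
Proof.
rewrite exchange_big; apply: eq_bigr => k _ /=.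
by rewrite summxE mulr_sumr.
Qed.

Lemma dot_ge0 u : 0 <= dot u u.
Proof. by apply: sumr_ge0 => k _; rewrite -expr2 sqr_ge0. Qed.

Lemma dot_eq0 u : dot u u = 0 -> u = 0.
Proof.
move=> u0; apply/rowP => k; rewrite mxE; apply/eqP.
rewrite -sqrf_eq0 expr2; apply/eqP; move: k (erefl true).
by apply: psumr_eq0P u0 => k _; rewrite -expr2 sqr_ge0.
Qed.

Lemma row_free_injP k (Y : 'M[R]_(k, m)) :
  reflect (forall w : 'rV_k, w *m Y = 0 -> w = 0) (row_free Y).
Proof.
apply: (iffP idP) => [fY w wY|inj].
  by apply: (row_free_inj fY); rewrite wY mul0mx.
rewrite -kermx_eq0; apply/eqP/row_matrixP => i.
by rewrite row0; apply: inj; apply/sub_kermxP/row_sub.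
Qed.

(** A vector w with w Y Y^T = 0 has |w Y|^2 = 0, hence w Y = 0 since the scalars are ordered. *)
Lemma gram_unit k (Y : 'M[R]_(k, m)) : row_free Y -> Y *m Y^T \in unitmx.
Proof.
move=> fY; rewrite -row_free_unit -kermx_eq0; apply/eqP/row_matrixP => i.
rewrite row0; set w := row i _.
have: w *m (Y *m Y^T) = 0 by apply/sub_kermxP/row_sub.
move=> /(congr1 (fun z => z *m w^T)); rewrite mul0mx mulmxA -mulmxA -trmx_mul.
rewrite dotE => /matrixP/(_ 0 0); rewrite !mxE eqxx mulr1n => /dot_eq0.
by move/row_free_injP: fY; apply.
Qed.

(* Gram--Schmidt: [u] is [v] minus its projection on the row space of [Y], and
   subtracting it is a unimodular row operation. *)
Lemma gram_col_mx k (v : 'rV[R]_m) (Y : 'M[R]_(k, m)) : row_free Y ->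
  exists w : 'rV_k, let u := v - w *m Y in
    u *m Y^T = 0 /\ gram (col_mx v Y) = dot u u * gram Y.
Proof.
move=> fY; have A_unit := gram_unit fY; set A := Y *m Y^T in A_unit.
exists (v *m Y^T *m invmx A); set w := v *m _ *m _ => u.
have uY : u *m Y^T = 0 by rewrite mulmxBl -(mulmxA w) mulmxKV // subrr.
split=> //; rewrite /gram.
have -> : col_mx v Y = block_mx 1%:M w 0 1%:M *m col_mx u Y.
  by rewrite mul_block_col !mul1mx mul0mx add0r subrK.
rewrite trmx_mul mulmxA -(mulmxA _ (col_mx u Y)) !det_mulmx det_tr.
rewrite det_ublock !det1 mulr1 mul1r mulr1.
rewrite tr_col_mx mul_col_row uY -[Y *m u^T]trmxK trmx_mul trmxK uY trmx0.
by rewrite det_ublock dotE det_scalar1.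
Qed.

Lemma row_free_dsubmx k (Y : 'M[R]_(1 + k, m)) : row_free Y ->
  row_free (dsubmx Y).
Proof.
move=> /row_free_injP fY; apply/row_free_injP => w wY.
have w0 : row_mx (0 : 'M_1) w = 0.
  by apply: fY; rewrite -[Y]vsubmxK mul_row_col mul0mx add0r.
by rewrite -(row_mxKr (0 : 'M_1) w) w0; apply/rowP => j; rewrite !mxE.
Qed.

(** Hadamard's inequality by induction on the rows: the new factor is |u|^2, where u is the part of
    the first row v orthogonal to the others. It is nonzero by freeness, and |u|^2 <= |v|^2 by
    Pythagoras. *)
Lemma gram_gt0_le k (Y : 'M[R]_(k, m)) (B : R) : row_free Y ->
  (forall i, dot (row i Y) (row i Y) <= B) -> 0 < gram Y <= B ^+ k.
Proof.
elim: k Y => [|k IHk] Y fY YB; first by rewrite /gram det_mx00 ltr01 lexx.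
have fY' := row_free_dsubmx (k := k) fY.
set v := usubmx (Y : 'M_(1 + k, m)); set Y' := dsubmx (Y : 'M_(1 + k, m)).
have /andP[Y'gt0 Y'le] : 0 < gram Y' <= B ^+ k.
  apply: IHk => // i.
  have -> : row i Y' = row (rshift 1 i : 'I_k.+1) Y.
    by apply/rowP => j; rewrite !mxE.
  exact: YB.
have vB : dot v v <= B.
  have -> : v = row (lshift k (0 : 'I_1) : 'I_k.+1) Y.
    by apply/rowP => j; rewrite !mxE.
  exact: YB.
have [w [uY' gY]] := gram_col_mx v fY'; set u := v - _ in uY' gY.
have uw : dot u (w *m Y') = 0.
  have /matrixP/(_ 0 0) : u *m (w *m Y')^T = 0.
    by rewrite trmx_mul mulmxA uY' mul0mx.
  by rewrite dotE !mxE eqxx mulr1n.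
have {}gY : gram Y = dot u u * gram Y' by rewrite -gY vsubmxK.
have vE : v = u + w *m Y' by rewrite subrK.
have vv : dot v v = dot u u + dot (w *m Y') (w *m Y').
  clearbody u.
  by rewrite vE !(dotDl, dotDr) (dotC (w *m Y') u) uw addr0 add0r.
have u_gt0 : 0 < dot u u.
  rewrite lt_neqAle dot_ge0 andbT eq_sym; apply: contraTN (ltr01 : 0 < 1 :> R).
  move=> /eqP/dot_eq0/eqP; rewrite subr_eq0 => /eqP vw.
  move/row_free_injP: fY => /(_ (row_mx (1%:M) (- w) : 'rV_(1 + k))).
  have wY0 : row_mx 1%:M (- w) *m Y = 0.
    rewrite -[Y](vsubmxK (m1 := 1)) mul_row_col mul1mx mulNmx -/v -/Y'.
    by rewrite {1}vw subrr.
  move=> /(_ wY0)/matrixP/(_ 0 (lshift k (0 : 'I_1))).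
  by rewrite (@row_mxEl _ 1 1 k) !mxE eqxx mulr1n => ->; rewrite ltxx.
rewrite gY mulr_gt0 //= exprS ler_pM ?dot_ge0 ?(ltW Y'gt0) //.
apply: le_trans vB; rewrite vv lerDl dot_ge0 //.
Qed.

Lemma gram_int k (Y : 'M[R]_(k, m)) : (forall i j, Y i j \is a Num.int) ->
  gram Y \is a Num.int.
Proof.
move=> Yint; apply: rpred_sum => s _; apply: rpredM.
  by rewrite rpredX // rpredN1.
apply: rpred_prod => i _; rewrite mxE; apply: rpred_sum => j _.
by rewrite mxE rpredM.
Qed.

(** Write w Y = w_0 u + z Y' with u orthogonal to the rows of Y'. Then |w Y|^2 >= w_0^2 |u|^2, and
    |u|^2 is the quotient of the positive integer [gram Y] by [gram Y'] <= B^k. *)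
Lemma coef0_bound k (Y : 'M[R]_(k.+1, m)) (w : 'rV_k.+1) (B : R) :
    row_free Y -> (forall i j, Y i j \is a Num.int) ->
    (forall i, dot (row i Y) (row i Y) <= B) ->
  w 0 0 ^+ 2 <= B ^+ k * dot (w *m Y) (w *m Y).
Proof.
move=> fY Yint YB; have fY' := row_free_dsubmx (k := k) fY.
set v := usubmx (Y : 'M_(1 + k, m)); set Y' := dsubmx (Y : 'M_(1 + k, m)).
have /andP[Y'gt0 Y'le] : 0 < gram Y' <= B ^+ k.
  apply: gram_gt0_le => // i.
  have -> : row i Y' = row (rshift 1 i : 'I_k.+1) Y.
    by apply/rowP => j; rewrite !mxE.
  exact: YB.
have gY_ge1 : 1 <= gram Y.
  have /andP[gY_gt0 _] := gram_gt0_le fY YB.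
  have /intrP[z gYz] := gram_int Yint.
  by move: gY_gt0; rewrite gYz ltr0z ler1z gtz0_ge1.
have [w' [uY' gY]] := gram_col_mx v fY'; set u := v - _ in uY' gY.
have {}gY : gram Y = dot u u * gram Y' by rewrite -gY vsubmxK.
(* [z] collects the coefficients on the remaining rows, including the projection of w_0 v onto their
   span. *)
pose z := rsubmx (w : 'rV_(1 + k)) + w 0 0 *: w'.
have wY : w *m Y = w 0 0 *: u + z *m Y'.
  transitivity (w 0 0 *: v + rsubmx (w : 'rV_(1 + k)) *m Y').
    have {1}-> : w = row_mx (lsubmx (w : 'rV_(1 + k))) (rsubmx (w : 'rV_(1 + k))).
      by rewrite hsubmxK.
    have {1}-> : Y = col_mx v Y' by rewrite vsubmxK.
    rewrite (@mul_row_col _ 1 1 k m) [lsubmx _]mx11_scalar mul_scalar_mx.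
    by congr (_ *: _ + _); rewrite mxE; congr (w _ _); apply/val_inj.
  by rewrite mulmxDl scalerBr -scalemxAl [X in _ = _ + X]addrC addrA subrK.
have uz : dot u (z *m Y') = 0.
  have /matrixP/(_ 0 0) : u *m (z *m Y')^T = 0.
    by rewrite trmx_mul mulmxA uY' mul0mx.
  by rewrite dotE !mxE eqxx mulr1n.
have -> : dot (w *m Y) (w *m Y) = w 0 0 ^+ 2 * dot u u + dot (z *m Y') (z *m Y').
  rewrite wY; clearbody u z.
  by rewrite !(dotDl, dotDr, dotZl, dotZr) (dotC (z *m Y') u) uz; ring.
apply: (@le_trans _ _ (w 0 0 ^+ 2 * gram Y)).
  by rewrite ler_peMr ?sqr_ge0.
rewrite gY mulrA mulrC; apply: ler_pM => //; first exact: ltW.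
  by rewrite mulr_ge0 ?dot_ge0 // sqr_ge0.
by rewrite lerDl dot_ge0.
Qed.

(** Swapping rows 0 and j reduces this to [coef0_bound]. *)
Lemma coef_bound k (Y : 'M[R]_(k, m)) (w : 'rV_k) (B : R) :
    row_free Y -> (forall i j, Y i j \is a Num.int) ->
    (forall i, dot (row i Y) (row i Y) <= B) ->
  forall j, w 0 j ^+ 2 <= B ^+ k.-1 * dot (w *m Y) (w *m Y).
Proof.
case: k Y w => [|k] Y w fY Yint YB j; first by case: j.
pose P : 'M[R]_k.+1 := perm_mx (tperm 0 j).
have PP : P *m P = 1%:M by rewrite -perm_mxM tperm2 perm_mx1.
have rP i : row i (P *m Y) = row (tperm 0 j i) Y.
  by rewrite -row_permE; apply/rowP => l; rewrite !mxE.
have -> : w 0 j = (w *m P) 0 0.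
  by rewrite /P -[tperm 0 j]tpermV -col_permE mxE tpermL.
have -> : w *m Y = (w *m P) *m (P *m Y).
  by rewrite mulmxA -(mulmxA w) PP mulmx1.
apply: coef0_bound => [|i l|i]; last by rewrite rP.
  apply/row_free_injP => z; rewrite mulmxA => /(row_free_injP _ fY) zP.
  by rewrite -[z]mulmx1 -PP mulmxA zP mul0mx.
by rewrite -row_permE mxE.
Qed.

(* Caratheodory's theorem for cones: subtract from [w] the largest multiple of
   a linear relation that keeps it nonnegative. *)
Lemma conic_free k (Y : 'M[R]_(k, m)) (w : 'rV_k) : (forall i, 0 <= w 0 i) ->
  exists k' (f : 'I_k' -> 'I_k) (w' : 'rV_k'),
    [/\ row_free (rowsub f Y), forall i, 0 <= w' 0 i &
        w *m Y = w' *m rowsub f Y].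
Proof.
elim: k Y w => [|k IHk] Y w w_ge0.
  exists 0%N, id, w; split=> //.
    by apply/row_free_injP => z _; apply/rowP; case.
  by congr (_ *m _); apply/matrixP; case.
have [fY|nfY] := boolP (row_free Y).
  have idY : rowsub id Y = Y by apply/matrixP => i j; rewrite mxE.
  by exists k.+1, id, w; rewrite idY.
have [c [cY [i0 ci0]]] : exists c : 'rV_k.+1, c *m Y = 0 /\ exists i, 0 < c 0 i.
  move: nfY; rewrite -kermx_eq0 => /rowV0Pn[c /sub_kermxP cY /rV0Pn[i]].
  rewrite neq_lt => /orP[ci|ci]; last by exists c; split=> //; exists i.
  exists (- c); rewrite mulNmx cY oppr0; split=> //; exists i.
  by rewrite mxE oppr_gt0.
have [i ci imin] := @arg_minP _ _ _ i0 (fun i => 0 < c 0 i)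
  (fun i => w 0 i / c 0 i) ci0.
pose w' := w - (w 0 i / c 0 i) *: c.
have w'i : w' 0 i = 0 by rewrite !mxE divfK ?subrr ?gt_eqF.
have w'_ge0 j : 0 <= w' 0 j.
  rewrite !mxE subr_ge0; have [cj|cj] := ltP 0 (c 0 j).
    by rewrite -ler_pdivlMr // imin.
  apply: le_trans (w_ge0 j); rewrite mulr_ge0_le0 //.
  by rewrite divr_ge0 // ltW.
have [|k' [f [w'' [fY w''_ge0 wY]]]] := IHk (row' i Y) (col' i w').
  by move=> j; rewrite mxE.
exists k', (lift i \o f), w''.
have rE : rowsub (lift i \o f) Y = rowsub f (row' i Y).
  by apply/matrixP => a b; rewrite !mxE.
split=> //; first by rewrite rE.
rewrite rE -wY.
have -> : w *m Y = w' *m Y by rewrite mulmxBl -scalemxAl cY scaler0 subr0.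
apply/rowP => b; rewrite !mxE (bigD1 i) //= w'i mul0r add0r.
rewrite (reindex_omap (lift i) (unlift i)) => [|j] /=.
  apply: eq_big => [j|j _]; rewrite ?neq_lift ?mxE //.
  by rewrite eq_sym neq_lift liftK eqxx.
by case: unliftP => [j' ->|->]; rewrite ?eqxx.
Qed.

End Gram.

(** * Bounding a vector by a conic combination of integral changes *)

Lemma norm2E (R : realType) m (x : 'rV[R]_m) : norm2 x = Num.sqrt (dot x x).
Proof. by congr Num.sqrt; apply: eq_bigr => i _; rewrite expr2. Qed.

(** The rows are orthogonal to the all-ones vector, which costs one dimension. *)
Lemma rank_sum0 (R : realType) m k (Z : 'M[R]_(k, m.+1)) :
  (forall i, \sum_j Z i j = 0) -> (\rank Z <= m)%N.
Proof.
move=> Z0; have Z1 : Z *m const_mx 1 = 0 :> 'cV_k.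
  apply/matrixP => i j; rewrite mxE [RHS]mxE -[RHS](Z0 i).
  by apply: eq_bigr => l _; rewrite mxE mulr1.
have := mulmx0_rank_max Z1.
suff -> : \rank (const_mx 1 : 'cV[R]_m.+1) = 1%N by rewrite addn1.
apply/eqP; rewrite eqn_leq rank_leq_col lt0n mxrank_eq0.
apply/eqP => /matrixP/(_ 0 0)/eqP; rewrite !mxE; exact/negP/oner_neq0.
Qed.

(** The linear algebra of the argument, freed from graphs: [y] are the changes, [lam] their weights,
    [d] the deviation. The number of classes is written [m.+2]. *)
Lemma descent_bound (R : realType) (m : nat) (I : finType)
    (y : I -> 'rV[R]_m.+2) (lam : I -> R) (C s : R) (d : 'rV[R]_m.+2) :
    0 < C -> 1 <= s -> (forall i, 0 <= lam i) ->
    (forall i j, y i 0 j \is a Num.int) -> (forall i, \sum_j y i 0 j = 0) ->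
    (forall i, dot (y i) (y i) <= 2 * s ^+ 2) ->
    (forall i, - s ^+ 2 <= dot (y i) d) ->
    \sum_i lam i *: y i = - (C *: d) ->
  norm2 d <= m.+1%:R * s ^+ 2 * Num.sqrt ((2 * s ^+ 2) ^+ m).
Proof.
move=> C_gt0 s_ge1 lam_ge0 yint y0 yB yd lamy; set B := 2 * s ^+ 2.
have B_ge1 : 1 <= B by rewrite /B; nra.
pose Y := \matrix_(i < #|I|) y (enum_val i).
pose w : 'rV_#|I| := \row_i (lam (enum_val i) / C).
have wY : w *m Y = - d.
  apply: (scalerI (lt0r_neq0 C_gt0)); rewrite scalerN -lamy mulmx_sum_row.
  rewrite scaler_sumr [RHS](reindex_onto enum_val enum_rank) => [|i _] /=; last first.
    by rewrite enum_rankK.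
  apply: eq_big => [i|i _]; first by rewrite enum_valK eqxx.
  by rewrite rowK mxE scalerA mulrC divfK ?gt_eqF.
have w_ge0 i : 0 <= w 0 i by rewrite mxE divr_ge0 // ltW.
have [k [f [w' [fZ w'_ge0]]]] := conic_free Y w_ge0.
set Z := rowsub f Y in fZ *; rewrite wY => dZ.
have rZ i : row i Z = y (enum_val (f i)) by rewrite row_rowsub rowK.
have ZE i j : Z i j = y (enum_val (f i)) 0 j by rewrite -rZ [RHS]mxE.
have k_le : (k <= m.+1)%N.
  rewrite -[leqLHS](eqP fZ); apply: rank_sum0 => i.
  by rewrite -[RHS](y0 (enum_val (f i))); apply: eq_bigr => j _.
set D2 := dot d d; have D2_ge0 : 0 <= D2 by apply: dot_ge0.
have Bm_ge0 : 0 <= B ^+ m by rewrite exprn_ge0 // (le_trans ler01).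
(* The exponent [k.-1] from [coef_bound] is at most m, and may be raised to m because B >= 1. *)
have w'_le j : w' 0 j <= Num.sqrt (B ^+ m * D2).
  rewrite -[leLHS]ger0_norm // -sqrtr_sqr ler_wsqrtr //.
  have := coef_bound w' fZ (B := B) _ _ j; rewrite -dZ.
  have -> : dot (- d) (- d) = D2.
    by apply: eq_bigr => l _; rewrite !mxE mulrNN.
  move=> H; apply: le_trans (H _ _) _ => [i l|i|]; rewrite ?ZE ?rZ //.
  apply: ler_wpM2r => //; apply: ler_weXn2l => //.
  by case: (k) k_le.
have D2_le : D2 <= m.+1%:R * s ^+ 2 * Num.sqrt (B ^+ m * D2).
  have {1}-> : D2 = \sum_j w' 0 j * - dot (y (enum_val (f j))) d.
    have dN : dot d (- d) = - D2 by rewrite -scaleN1r dotZr mulN1r.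
    rewrite -[LHS]opprK -dN dZ mulmx_sum_row dot_sumr -sumrN.
    by apply: eq_bigr => j _; rewrite dotZr rZ dotC mulrN.
  apply: (@le_trans _ _ (\sum_(j < k) s ^+ 2 * Num.sqrt (B ^+ m * D2))).
    apply: ler_sum => j _; rewrite [leRHS]mulrC.
    apply: (@le_trans _ _ (w' 0 j * s ^+ 2)).
      by rewrite ler_wpM2l // lerNl.
    by rewrite ler_wpM2r ?sqr_ge0.
  rewrite sumr_const card_ord -[leLHS]mulr_natl -[leRHS]mulrA.
  apply: ler_wpM2r; rewrite ?ler_nat //.
  by rewrite mulr_ge0 ?sqr_ge0 ?sqrtr_ge0.
(* Both sides of the last bound carry a factor |d|, which is cancelled unless it is 0. *)
rewrite norm2E -/D2; have [D0|D_neq0] := eqVneq D2 0.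
  rewrite D0 sqrtr0; apply: mulr_ge0; last exact: sqrtr_ge0.
  by apply: mulr_ge0; rewrite ?sqr_ge0.
have D_gt0 : 0 < Num.sqrt D2 by rewrite sqrtr_gt0 lt_neqAle eq_sym D_neq0.
rewrite -(ler_pM2r D_gt0) -[leLHS]expr2 sqr_sqrtr //.
by rewrite -[leRHS]mulrA -sqrtrM.
Qed.

(** * Averages over permutations, factors and moves *)

Section Averages.
Variables (R : comNzRingType) (T : finType).

(** The first swap sends a to a'. The second exchanges the image of b with b' and fixes a', as both
    of these points differ from a'. *)
Lemma perm_2transitive (a b a' b' : T) : a != b -> a' != b' ->
  exists s : {perm T}, s a = a' /\ s b = b'.
Proof.
move=> ab ab'; exists (tperm a a' * tperm (tperm a a' b) b')%g.
rewrite !permM tpermL; split; last by rewrite tpermL.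
rewrite tpermD 1?eq_sym //; rewrite -{1}(tpermL a a').
by rewrite (inj_eq perm_inj).
Qed.

(** The sum over permutations does not depend on a. Added up over all a, each permutation
    contributes every value of F once. *)
Lemma sum_perm1 (F : T -> R) a :
  #|T|%:R * \sum_(s : {perm T}) F (s a) = #|{perm T}|%:R * \sum_c F c.
Proof.
have GE b : \sum_(s : {perm T}) F (s a) = \sum_(s : {perm T}) F (s b).
  rewrite [RHS](reindex_inj (mulgI (tperm b a))) /=.
  by apply: eq_bigr => s _; rewrite permM tpermL.
rewrite mulr_natl -sumr_const (eq_bigr _ (fun b _ => GE b)) exchange_big /=.
rewrite (eq_bigr (fun=> \sum_c F c)) => [|s _]; last first.
  by rewrite [RHS](reindex_inj (@perm_inj _ s)).
by rewrite sumr_const mulr_natl.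
Qed.

(** The same averaging over ordered pairs of distinct points, with double transitivity making the
    sum independent of the pair. *)
Lemma sum_perm2 (F : T -> T -> R) a b : a != b ->
  (#|T|%:R * (#|T|%:R - 1)) * \sum_(s : {perm T}) F (s a) (s b) =
  #|{perm T}|%:R * \sum_c \sum_(c' | c' != c) F c c'.
Proof.
move=> ab; set G := (X in _ * X = _).
have GE c c' : c' != c -> \sum_(s : {perm T}) F (s c) (s c') = G.
  rewrite eq_sym => cc'; have [u [<- <-]] := perm_2transitive ab cc'.
  rewrite /G [RHS](reindex_inj (mulgI u)) /=.
  by apply: eq_bigr => s _; rewrite !permM.
transitivity (\sum_c \sum_(c' | c' != c) \sum_(s : {perm T}) F (s c) (s c')).
  rewrite (eq_bigr (fun=> (#|T|%:R - 1) * G)) => [|c _].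
    by rewrite sumr_const -[RHS]mulr_natl mulrA.
  rewrite (eq_bigr (fun=> G)) => [|c'] //; last exact: GE.
  have T_gt0 : (0 < #|T|)%N by rewrite (cardD1 c).
  by rewrite sumr_const -[LHS]mulr_natl (cardC1 c) -subn1 natrB.
rewrite (eq_bigr _ (fun c _ => exchange_big _ _ _ _ _ _)) exchange_big /=.
rewrite (eq_bigr (fun=> \sum_c \sum_(c' | c' != c) F c c')) => [|s _].
  by rewrite sumr_const mulr_natl.
rewrite [RHS](reindex_inj (@perm_inj _ s)); apply: eq_bigr => c _ /=.
rewrite [RHS](reindex_inj (@perm_inj _ s)); apply: eq_bigl => c' /=.
by rewrite (inj_eq perm_inj).
Qed.

(** The permutations at z and z' are independent, so the two images are uniform over all pairs,
    coinciding ones included: hence |T|^2 and not |T| (|T| - 1). *)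
Lemma sum_ffun_perm2 (I : finType) (F : T -> T -> R) (z z' : I) y :
  z != z' ->
  #|T|%:R ^+ 2 * \sum_(p : {ffun I -> {perm T}}) F (p z y) (p z' y) =
  #|{ffun I -> {perm T}}|%:R * \sum_c \sum_c' F c c'.
Proof.
move=> zz'; set G := (X in _ * X = _).
have GE c c' : \sum_(p : {ffun I -> {perm T}}) F (p z c) (p z' c') = G.
  (* Precomposing with these swaps turns the value at y into the value at c in component z, and at
     c' in component z'. *)
  pose h (p : {ffun I -> {perm T}}) : {ffun I -> {perm T}} :=
    [ffun x => ((if x == z then tperm y c else tperm y c') * p x)%g].
  have h_inj : injective h.
    move=> p p' /ffunP hp; apply/ffunP => x.
    by have := hp x; rewrite !ffunE => /mulgI.
  rewrite /G [RHS](reindex_inj h_inj); apply: eq_bigr => p _ /=.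
  by rewrite !ffunE eqxx eq_sym (negPf zz') !permM !tpermL.
transitivity (\sum_c \sum_c' \sum_(p : {ffun I -> {perm T}}) F (p z c) (p z' c')).
  under eq_bigr do under eq_bigr do rewrite GE.
  by rewrite !sumr_const -mulrnA -[RHS]mulr_natl natrM expr2.
rewrite (eq_bigr _ (fun c _ => exchange_big _ _ _ _ _ _)) exchange_big /=.
rewrite (eq_bigr (fun=> \sum_c \sum_c' F c c')) => [|p _].
  by rewrite sumr_const mulr_natl.
rewrite [RHS](reindex_inj (@perm_inj _ (p z))); apply: eq_bigr => c _ /=.
by rewrite [RHS](reindex_inj (@perm_inj _ (p z'))).
Qed.
End Averages.

(** * Edge counts of factors as sums over ordered adjacent pairs *)

Lemma sum_adjacent (R : comNzRingType) (V : finType) (S : {set {set V}})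
    (F : {set V} -> R) : (forall e, e \in S -> #|e| = 2%N) ->
  \sum_(p | [set p.1; p.2] \in S) F [set p.1; p.2] = 2 * \sum_(e in S) F e.
Proof.
move=> S2; rewrite (partition_big (fun p => [set p.1; p.2]) (mem S)) //= mulr_sumr.
apply: eq_bigr => e eS.
have /eqP/cards2P[x [y [xy eE]]] := S2 e eS.
rewrite (eq_bigr (fun=> F e)) => [|p /andP[_ /eqP->] //].
rewrite sumr_const mulr_natl; congr (_ *+ _).
have -> : 2%N = #|[set (x, y); (y, x)]|.
  by rewrite cards2 xpair_eqE (negPf xy).
apply: eq_card => -[a b]; rewrite [LHS]unfold_in /= !inE !xpair_eqE.
apply/andP/orP => [[_ /eqP abe]|]; last first.
  by case=> /andP[/eqP-> /eqP->]; rewrite -?eE ?eqxx // setUC -eE eqxx.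
have : a \in [set x; y] by rewrite -eE -abe set21.
have : b \in [set x; y] by rewrite -eE -abe set22.
have : x \in [set a; b] by rewrite abe eE set21.
have : y \in [set a; b] by rewrite abe eE set22.
rewrite !inE => /orP[/eqP-> | /eqP->] /orP[/eqP-> | /eqP->];
  rewrite !eqxx ?orbb ?orbT ?andbT /=; by auto.
Qed.

(** Each edge enters in both directions; hence the factors 2 in the counting identities. *)
Definition edge_sum (R : nmodType) (T : graph) (W : Type) (f : W -> W -> R)
    (p : T -> W) : R :=
  \sum_(e | [set e.1; e.2] \in edges T) f (p e.1) (p e.2).

Lemma adj_neq (T : graph) (a b : T) : [set a; b] \in edges T -> a != b.
Proof. by move=> /card_edge; rewrite cards2; case: (a != b). Qed.

Lemma sum_adj_const (R : comNzRingType) (T : graph) (c : R) :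
  \sum_(e : T * T | [set e.1; e.2] \in edges T) c = 2 * #|edges T|%:R * c.
Proof.
rewrite (sum_adjacent (fun=> c)); last exact: card_edge.
by rewrite sumr_const -[c *+ _]mulr_natl mulrA.
Qed.

Section Copies.
Variables (T : graph) (n : nat).

Lemma copy_edgesS (f : T -> 'I_n) : injective f ->
  [set f @: (e : {set T}) | e in edges T] \subset edges (complete n).
Proof.
move=> f_inj; apply/subsetP => _ /imsetP[e eT ->].
by rewrite inE card_imset // (card_edge eT).
Qed.

Lemma copy_ends (f : T -> 'I_n) (e : {set 'I_n}) :
  e \in [set f @: (e : {set T}) | e in edges T] -> e \subset f @: [set: T].
Proof. by move=> /imsetP[e' _ ->]; apply: imsetS; apply: subsetT. Qed.

Definition copy (f : T -> 'I_n) (f_inj : injective f) : subgraph (complete n) :=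
  @Subgraph (complete n) _ _ (copy_edgesS f_inj) (@copy_ends f).

Variables (N : nat) (phi : 'I_N * T -> 'I_n).
Hypothesis phi_inj : injective phi.

Lemma block_inj i : injective (fun a => phi (i, a)).
Proof. by move=> a b /phi_inj[]. Qed.

Definition blocks (i : 'I_N) := copy (@block_inj i).

Lemma blocks_edgesS :
  \bigcup_i sub_edges (blocks i) \subset edges (complete n).
Proof. by apply/bigcupsP => i _; apply: sub_edgesS. Qed.

Lemma blocks_ends (e : {set 'I_n}) : e \in \bigcup_i sub_edges (blocks i) ->
  e \subset \bigcup_i sub_vertices (blocks i).
Proof.
move=> /bigcupP[i _ ei]; have ev := @sub_edges_ends _ (blocks i) e ei.
apply: (subset_trans ev).
exact: bigcup_sup.
Qed.

Definition factor : subgraph (complete n) :=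
  @Subgraph (complete n) _ _ blocks_edgesS blocks_ends.

(** Distinct blocks have disjoint vertex sets, so an edge of the factor determines its block, and
    injectivity recovers the edge of T. *)
Lemma factor_adj i j a b :
  ([set phi (i, a); phi (j, b)] \in sub_edges factor) =
  (i == j) && ([set a; b] \in edges T).
Proof.
apply/bigcupP/andP => [[k _ /imsetP[e eT E]]|[/eqP<- abT]]; last first.
  exists i => //; apply/imsetP; exists [set a; b] => //.
  by rewrite imsetU1 imset_set1.
have /imsetP[c ce /phi_inj[ik _]] : phi (i, a) \in (fun a => phi (k, a)) @: e.
  by rewrite -E set21.
have /imsetP[c' c'e /phi_inj[jk _]] : phi (j, b) \in (fun a => phi (k, a)) @: e.
  by rewrite -E set22.
rewrite {}jk {}ik in E *; split=> //; suff <- : e = [set a; b] by [].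
apply: (imset_inj (@block_inj k)).
by rewrite -E imsetU1 imset_set1.
Qed.

(** The bijection [phi] names the vertices of K_n by pairs of a copy and a vertex of T, and
    [factor_adj] confines the sum to one copy at a time. *)
Lemma count_factorE (R : realType) m (P : 'I_m -> {set {set complete n}}) k :
    bijective phi ->
  2 * count_vec R factor P 0 k =
  \sum_i edge_sum (fun p p' => ([set phi p; phi p'] \in P k)%:R)
    (fun a => (i, a)).
Proof.
move=> phi_bij; rewrite mxE.
have -> : #|P k :&: sub_edges factor|%:R =
    \sum_(e in sub_edges factor) (e \in P k)%:R :> R.
  rewrite -sum1_card natr_sum big_mkcond [RHS]big_mkcond.
  by apply: eq_bigr => e _; rewrite inE andbC; case: (e \in _); case: (e \in _).
rewrite -(@sum_adjacent _ 'I_n _ (fun e => (e \in P k)%:R)); last first.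
  move=> e /(subsetP blocks_edgesS); exact: card_edge.
rewrite -(pair_big_dep xpredT (fun u v : 'I_n => [set u; v] \in sub_edges factor)
  (fun u v : 'I_n => ([set u; v] \in P k)%:R)) /=.
rewrite (reindex phi (onW_bij _ phi_bij)) /=.
rewrite (eq_bigr (fun p => \sum_(b | [set p.2; b] \in edges T)
  ([set phi (p.1, p.2); phi (p.1, b)] \in P k)%:R)) => [|[i a] _].
  rewrite -(pair_bigA _ (fun i a => \sum_(b | [set a; b] \in edges T)
    ([set phi (i, a); phi (i, b)] \in P k)%:R)) /=.
  by apply: eq_bigr => i _; rewrite pair_big_dep.
rewrite (reindex phi (onW_bij _ phi_bij)) /=.
rewrite (eq_big (fun p => (i == p.1) && ([set a; p.2] \in edges T))
  (fun p => ([set phi (i, a); phi (p.1, p.2)] \in P k)%:R))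
  => [|[j b]|[j b] _] //=.
  rewrite -(pair_big_dep (fun j => i == j) (fun j b => [set a; b] \in edges T)
    (fun j b => ([set phi (i, a); phi (j, b)] \in P k)%:R)) /=.
  by rewrite (big_pred1 i) // => j; rewrite eq_sym.
exact: factor_adj.
Qed.

End Copies.

Lemma count_fullE (R : realType) (W : finType) n (phi : W -> 'I_n) m
    (P : 'I_m -> {set {set complete n}}) k : bijective phi ->
    edge_partition P ->
  2 * count_vec R (full (complete n)) P 0 k =
  \sum_p \sum_(p' | p' != p) ([set phi p; phi p'] \in P k)%:R.
Proof.
move=> phi_bij [_ coverP]; rewrite mxE.
have -> : #|P k :&: sub_edges (full (complete n))|%:R =
    \sum_(e in edges (complete n)) (e \in P k)%:R :> R.
  rewrite -sum1_card natr_sum big_mkcond [RHS]big_mkcond.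
  by apply: eq_bigr => e _; rewrite inE andbC; case: (e \in _); case: (e \in _).
rewrite -(@sum_adjacent _ 'I_n _ (fun e => (e \in P k)%:R)); last first.
  exact: (@card_edge (complete n)).
rewrite -(pair_big_dep xpredT (fun u v : 'I_n => [set u; v] \in edges (complete n))
  (fun u v : 'I_n => ([set u; v] \in P k)%:R)) /=.
rewrite (reindex phi (onW_bij _ phi_bij)) /=; apply: eq_bigr => p _.
rewrite (reindex phi (onW_bij _ phi_bij)) /=; apply: eq_bigl => p'.
by rewrite inE cards2 (inj_eq (bij_inj phi_bij)) (eq_sym p'); case: (p == p').
Qed.

Lemma sum_classes (R : realType) (G : graph) m (P : 'I_m -> {set {set G}}) e :
  edge_partition P -> \sum_k (e \in P k)%:R = (e \in edges G)%:R :> R.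
Proof.
move=> [disP <-]; have [/bigcupP[k _ ek]|/bigcupP eP] := boolP (e \in \bigcup_k P k).
  rewrite (bigD1 k) //= ek big1 ?addr0 // => l lk.
  by rewrite (disjointFl (disP _ _ lk)).
rewrite big1 // => k _; case: (boolP (e \in P k)) => // ek.
by case: eP; exists k.
Qed.

Lemma factorP (T : graph) n (phi : 'I_(n %/ #|T|) * T -> 'I_n)
  (phi_inj : injective phi) : is_factor T (factor phi_inj).
Proof.
exists (blocks phi_inj); split=> // [i|i j ij].
  by exists (fun a => phi (i, a)); split=> //; apply: block_inj.
rewrite -setI_eq0; apply: contraNT ij => /set0Pn[_ /setIP[/imsetP[a _ ->]]].
by move=> /imsetP[b _ /phi_inj[->]].
Qed.

Lemma eq_edge_sum (R : nmodType) (T : graph) (W : Type) (f : W -> W -> R)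
  (p p' : T -> W) : p =1 p' -> edge_sum f p = edge_sum f p'.
Proof. by move=> pE; apply: eq_bigr => e _; rewrite !pE. Qed.

Lemma sum_pairE (R : nmodType) (I J : finType) (F : I * J -> R) :
  \sum_x F x = \sum_i \sum_j F (i, j).
Proof. by rewrite pair_bigA; apply: eq_bigr => -[]. Qed.

(** * Moves on a factor and their weighted average *)

Section Moves.
Variables (R : realType) (T : graph) (N : nat) (iota : T -> 'I_N).
Hypothesis iota_inj : injective iota.
Local Notation W := ('I_N * T)%type.
Local Notation transversals := ({perm 'I_N} * {ffun T -> {perm T}})%type.

(** On the left, [rho] after [iota] selects |T| copies, indexed by T itself, and the permutations
    [pi] regroup their vertices into transversal copies. On the right, one copy is embedded anew. *)
Definition move : finType := (transversals + 'I_N * {perm T})%type.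

(** Vertex z of the new copy y lies in the old copy [rho (iota z)], at position [pi z y]. For fixed
    z these positions run over T as y varies, so the new copies are disjoint and cover the selected
    ones. *)
Definition move_fun (x : move) (p : W) : W :=
  match x with
  | inl (rho, pi) =>
      if [pick y | rho (iota y) == p.1] is Some y
      then (rho (iota p.2), pi p.2 y) else p
  | inr (i, s) => if p.1 == i then (i, s p.2) else p
  end.

Lemma move_fun_inj x : injective (move_fun x).
Proof.
case: x => [[rho pi]|[i s]] [i1 a1] [i2 a2] /=.
  case: pickP => [y1 /eqP <-|no1]; case: pickP => [y2 /eqP <-|no2] //.
  - by case=> /perm_inj/iota_inj -> /perm_inj ->.
  - by case=> /eqP i2E; rewrite no2 in i2E.
  - by case=> /esym/eqP i1E; rewrite no1 in i1E.
case: eqP => [->|ni1]; case: eqP => [->|ni2] //.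
- by case=> /perm_inj ->.
- by case=> i2E; case: ni2.
- by case=> i1E; case: ni1.
Qed.

Definition move_perm x : {perm W} := perm (@move_fun_inj x).

Section Gain.
Variable f : W -> W -> R.
Let t : R := #|T|%:R.
Let q : R := #|edges T|%:R.

Definition blocks_sum (p : W -> W) : R :=
  \sum_i edge_sum f (fun a => p (i, a)).

Definition move_new (x : move) : R :=
  match x with
  | inl (rho, pi) => \sum_y edge_sum f (fun z => (rho (iota z), pi z y))
  | inr (i, s) => edge_sum f (fun z => (i, s z))
  end.

Definition move_old (x : move) : R :=
  match x with
  | inl (rho, pi) => \sum_y edge_sum f (fun z => (rho (iota y), z))
  | inr (i, s) => edge_sum f (fun z => (i, z))
  end.

(** The copies that the move leaves alone cancel. *)
Lemma blocks_sum_move x :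
  blocks_sum (move_perm x) - blocks_sum id = move_new x - move_old x.
Proof.
rewrite -sumrB; case: x => [[rho pi]|[i s]] /=; last first.
  rewrite (bigD1 i) //= big1 ?addr0 => [|j ji].
    by congr (_ - _); apply: eq_edge_sum => a; rewrite permE /= eqxx.
  apply/eqP; rewrite subr_eq0; apply/eqP/eq_edge_sum => a.
  by rewrite permE /= (negPf ji).
rewrite -sumrB (bigID (mem [set rho (iota y) | y in T])) /= addrC big1 ?add0r.
  rewrite big_imset /= => [|y y' _ _ /perm_inj/iota_inj //].
  apply: eq_bigr => y _; congr (_ - _); apply: eq_edge_sum => a.
  rewrite permE /=; case: pickP => [y' /eqP/perm_inj/iota_inj -> //|/(_ y)].
  by rewrite eqxx.
move=> i iN; apply/eqP; rewrite subr_eq0; apply/eqP/eq_edge_sum => a.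
rewrite permE /=; case: pickP => // y /eqP yi.
by case/imsetP: iN; exists y.
Qed.

(** For a fixed y and adjacent pair e, averaging over [rho] spreads the two copies evenly over
    ordered pairs of distinct copies, and averaging over [pi] spreads the positions evenly within
    them. *)
Lemma sum_transversal_new :
  (t ^+ 2 * (N%:R * (N%:R - 1))) *
    \sum_(x : transversals) move_new (inl x) =
  2 * q * t * #|{ffun T -> {perm T}}|%:R * #|{perm 'I_N}|%:R *
    \sum_i \sum_(j | j != i) \sum_a \sum_b f (i, a) (j, b).
Proof.
set Cr := \sum_i _; set X := \sum_(x : transversals) _.
have -> : X = \sum_(e : T * T | [set e.1; e.2] \in edges T) \sum_y
    \sum_(rho : {perm 'I_N}) \sum_(pi : {ffun T -> {perm T}})
    f (rho (iota e.1), pi e.1 y) (rho (iota e.2), pi e.2 y).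
  transitivity (\sum_(rho : {perm 'I_N})
      \sum_(e : T * T | [set e.1; e.2] \in edges T) \sum_y
      \sum_(pi : {ffun T -> {perm T}})
    f (rho (iota e.1), pi e.1 y) (rho (iota e.2), pi e.2 y)).
    rewrite /X sum_pairE /=.
    apply: eq_bigr => rho _; rewrite exchange_big [RHS]exchange_big /=.
    by apply: eq_bigr => y _; rewrite exchange_big.
  by rewrite exchange_big; apply: eq_bigr => e _; rewrite exchange_big.
rewrite mulr_sumr; transitivity (\sum_(e : T * T | [set e.1; e.2] \in edges T)
  (t * #|{ffun T -> {perm T}}|%:R * #|{perm 'I_N}|%:R * Cr)); last first.
  by rewrite sum_adj_const /q; ring.
apply: eq_bigr => e /adj_neq e12; rewrite mulr_sumr.
rewrite (eq_bigr (fun=>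
  #|{ffun T -> {perm T}}|%:R * #|{perm 'I_N}|%:R * Cr)) => [|y _].
  by rewrite sumr_const -[LHS]mulr_natl /t; ring.
pose F i j := \sum_c \sum_c' f (i, c) (j, c').
transitivity (N%:R * (N%:R - 1) * \sum_(rho : {perm 'I_N})
    (#|{ffun T -> {perm T}}|%:R * F (rho (iota e.1)) (rho (iota e.2)))).
  rewrite (mulrC (t ^+ 2)) -[LHS]mulrA; congr (_ * _); rewrite mulr_sumr.
  by apply: eq_bigr => rho _; rewrite /F -(sum_ffun_perm2 _ y e12).
have ie12 : iota e.1 != iota e.2 by rewrite (inj_eq iota_inj).
have := sum_perm2 F ie12; rewrite card_ord -mulr_sumr => FE.
by rewrite mulrCA FE mulrA.
Qed.

Lemma sum_transversal_old :
  N%:R * \sum_(x : transversals) move_old (inl x) =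
  t * #|{ffun T -> {perm T}}|%:R * #|{perm 'I_N}|%:R * blocks_sum id.
Proof.
rewrite sum_pairE /=.
rewrite (eq_bigr (fun rho : {perm 'I_N} => #|{ffun T -> {perm T}}|%:R *
  \sum_y edge_sum f (fun z => (rho (iota y), z)))) => [|rho _]; last first.
  by rewrite sumr_const -[LHS]mulr_natl.
rewrite -mulr_sumr exchange_big /= mulrCA mulr_sumr.
rewrite (eq_bigr (fun=> #|{perm 'I_N}|%:R * blocks_sum id)) => [|y _].
  by rewrite sumr_const -[X in _ * X]mulr_natl /t; ring.
have := sum_perm1 (fun i => edge_sum f (fun z => (i, z))) (iota y).
by rewrite card_ord.
Qed.

Lemma sum_self_new :
  t * (t - 1) * \sum_(x : 'I_N * {perm T}) move_new (inr x) =
  2 * q * #|{perm T}|%:R * \sum_i \sum_a \sum_(b | b != a) f (i, a) (i, b).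
Proof.
rewrite sum_pairE /= !mulr_sumr.
apply: eq_bigr => i _; rewrite exchange_big mulr_sumr /=.
rewrite -mulrA -sum_adj_const; apply: eq_bigr => e /adj_neq e12.
exact: (sum_perm2 (fun a b => f (i, a) (i, b)) e12).
Qed.

Lemma sum_self_old :
  \sum_(x : 'I_N * {perm T}) move_old (inr x) = #|{perm T}|%:R * blocks_sum id.
Proof.
rewrite sum_pairE /= mulr_sumr.
by apply: eq_bigr => i _; rewrite sumr_const -[LHS]mulr_natl.
Qed.

Lemma sum_pairs_split :
  \sum_(p : W) \sum_(p' | p' != p) f p p' =
  \sum_i \sum_(j | j != i) \sum_a \sum_b f (i, a) (j, b) +
  \sum_i \sum_a \sum_(b | b != a) f (i, a) (i, b).
Proof.
rewrite sum_pairE /=.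
rewrite -big_split; apply: eq_bigr => i _ /=.
rewrite [X in _ = X + _]exchange_big -big_split; apply: eq_bigr => a _ /=.
rewrite (eq_big (fun p => xpredT p.1 && ((p.1, p.2) != (i, a)))
   (fun p => f (i, a) (p.1, p.2))) => [|[j b]|[j b] _] //.
rewrite -(pair_big_dep xpredT (fun j b => (j, b) != (i, a))
  (fun j b => f (i, a) (j, b))) /= (bigD1 i) //= addrC; congr (_ + _).
  apply: eq_bigr => j ji; apply: eq_bigl => b.
  by rewrite xpair_eqE (negPf ji).
by apply: eq_bigl => b; rewrite xpair_eqE eqxx.
Qed.

(** Normalized so that in the total of the new terms pairs in different copies and pairs inside one
    copy receive the same coefficient 2 q. *)
Definition move_weight (x : move) : R :=
  match x with
  | inl _ => t * N%:R * (N%:R - 1) /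
      (#|{ffun T -> {perm T}}|%:R * #|{perm 'I_N}|%:R)
  | inr _ => t * (t - 1) / #|{perm T}|%:R
  end.

Lemma move_weight_ge0 x : (0 < N)%N -> (0 < #|T|)%N -> 0 <= move_weight x.
Proof.
move=> N_gt0 T_gt0; have N1 : 0 <= N%:R - 1 :> R by rewrite subr_ge0 ler1n.
have t1 : 0 <= t - 1 by rewrite subr_ge0 ler1n.
by case: x => x /=; rewrite divr_ge0 ?mulr_ge0.
Qed.

(** With t N = n and [f] the indicator of a class, this is 2 t (n - 1) times the difference between
    the mean and the count of the factor in that class. *)
Lemma sum_gain : (1 < N)%N -> (1 < #|T|)%N ->
  \sum_x move_weight x * (move_new x - move_old x) =
  2 * q * \sum_(p : W) \sum_(p' | p' != p) f p p' -
    t * (t * N%:R - 1) * blocks_sum id.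
Proof.
move=> N_gt1 T_gt1; have N_neq0 : N%:R != 0 :> R by rewrite pnatr_eq0 -lt0n ltnW.
have t_neq0 : t != 0 by rewrite pnatr_eq0 -lt0n ltnW.
have Pn : #|{ffun T -> {perm T}}|%:R != 0 :> R.
  by rewrite pnatr_eq0 (cardD1 [ffun=> 1%g]).
have Sn : #|{perm 'I_N}|%:R != 0 :> R by rewrite pnatr_eq0 (cardD1 1%g).
have Tn : #|{perm T}|%:R != 0 :> R by rewrite pnatr_eq0 (cardD1 1%g).
rewrite big_sumType /= -!mulr_sumr !sumrB sum_self_old.
rewrite sum_pairs_split; set Cr := \sum_i \sum_(j | _) _; set In := \sum_i _.
have := sum_transversal_new; have := sum_transversal_old; have := sum_self_new.
rewrite -/Cr -/In.
set X1 := \sum_x move_new _; set X2 := \sum_x move_old _.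
set X3 := \sum_x move_new _.
set B := blocks_sum id => E1 E2 E3.
have t1_neq0 : t - 1 != 0 by rewrite subr_eq0 (eqr_nat R _ 1) gtn_eqF.
have N1_neq0 : N%:R - 1 != 0 :> R by rewrite subr_eq0 (eqr_nat R _ 1) gtn_eqF.
have div_eq (a b x : R) : a != 0 -> a * x = b -> x = b / a.
  by move=> a0 <-; rewrite mulrC mulKf.
rewrite (div_eq _ _ _ _ E1) ?mulf_neq0 // (div_eq _ _ _ _ E2) //.
rewrite (div_eq _ _ _ _ E3) ?mulf_neq0 ?expf_neq0 //.
by field; rewrite t_neq0 N_neq0 Pn Sn Tn t1_neq0 N1_neq0.
Qed.

End Gain.
End Moves.

(** * The deviation of a factor *)

Lemma norm_le_norm2 (R : realType) m (x : 'rV[R]_m) : `|x| <= norm2 x.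
Proof.
rewrite -[`|x|]/(mx_norm x).
have [->|/mx_norm_neq0[[i j] -> /=]] := eqVneq (mx_norm x) 0.
  exact: sqrtr_ge0.
rewrite ord1 -sqrtr_sqr ler_wsqrtr // (bigD1 j) //= lerDl.
by apply: sumr_ge0 => k _; apply: sqr_ge0.
Qed.

Lemma dot_sub_le (R : realType) m (a b : 'rV[R]_m) (S : R) :
    (forall k, 0 <= a 0 k) -> (forall k, 0 <= b 0 k) ->
    \sum_k a 0 k <= S -> \sum_k b 0 k <= S ->
  dot (a - b) (a - b) <= 2 * S ^+ 2.
Proof.
move=> a_ge0 b_ge0 aS bS.
have sq (c : 'rV[R]_m) : (forall k, 0 <= c 0 k) -> \sum_k c 0 k <= S ->
    dot c c <= S ^+ 2.
  move=> c_ge0 cS; have S_ge0 : 0 <= S by apply: le_trans cS; apply: sumr_ge0.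
  apply: (@le_trans _ _ (\sum_k c 0 k * S)).
    apply: ler_sum => k _; apply: ler_wpM2l => //; apply: le_trans cS.
    by rewrite (bigD1 k) //= lerDl sumr_ge0.
  by rewrite -mulr_suml expr2 ler_wpM2r.
have ab : 0 <= dot a b by apply: sumr_ge0 => k _; apply: mulr_ge0.
have -> : dot (a - b) (a - b) = dot a a + dot b b - 2 * dot a b.
  rewrite -scaleN1r !(dotDl, dotDr, dotZl, dotZr) (dotC b a); ring.
by have := sq a a_ge0 aS; have := sq b b_ge0 bS; lra.
Qed.

Section Classes.
Variables (R : realType) (T : graph) (n m : nat).
Variable P : 'I_m -> {set {set complete n}}.
Hypothesis partP : edge_partition P.

Definition in_class (W : Type) (phi : W -> 'I_n) k (p p' : W) : R :=
  ([set phi p; phi p'] \in P k)%:R.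

Lemma sum_in_class (W : eqType) (phi : W -> 'I_n) p p' : injective phi ->
  \sum_k in_class phi k p p' = (p' != p)%:R.
Proof.
move=> phi_inj; rewrite (sum_classes R _ partP) inE cards2 (inj_eq phi_inj).
by rewrite (eq_sym p'); case: (p == p').
Qed.

Lemma sum_edge_sum_in_class (W : eqType) (phi : W -> 'I_n) (p : T -> W) :
    injective phi -> injective p ->
  \sum_k edge_sum (in_class phi k) p = 2 * #|edges T|%:R.
Proof.
move=> phi_inj p_inj; rewrite exchange_big -[RHS]mulr1 -sum_adj_const /=.
apply: eq_bigr => e /adj_neq e12.
by rewrite sum_in_class // (inj_eq p_inj) eq_sym e12.
Qed.

Lemma in_class_ge0 (W : Type) (phi : W -> 'I_n) k p p' :
  0 <= in_class phi k p p'.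
Proof. exact: ler0n. Qed.

Lemma edge_sum_in_class_ge0 (W : Type) (phi : W -> 'I_n) k (p : T -> W) :
  0 <= edge_sum (in_class phi k) p.
Proof. by apply: sumr_ge0 => e _; apply: in_class_ge0. Qed.

Lemma sum_count_factor N (phi : 'I_N * T -> 'I_n) (phi_inj : injective phi) :
    bijective phi ->
  \sum_k count_vec R (factor phi_inj) P 0 k = N%:R * #|edges T|%:R.
Proof.
move=> phi_bij; apply: (mulfI (_ : 2 != 0 :> R)); first by rewrite pnatr_eq0.
rewrite mulr_sumr (eq_bigr _ (fun k _ => count_factorE phi_inj R P k phi_bij)).
rewrite exchange_big /= (eq_bigr (fun=> 2 * #|edges T|%:R)) => [|i _].
  by rewrite sumr_const card_ord -[LHS]mulr_natl; ring.
by apply: (sum_edge_sum_in_class phi_inj) => a b [].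
Qed.

Lemma sum_count_full :
  \sum_k count_vec R (full (complete n)) P 0 k = n%:R * (n%:R - 1) / 2.
Proof.
apply: (mulfI (_ : 2 != 0 :> R)); first by rewrite pnatr_eq0.
have id_bij : bijective (@id 'I_n) by exists id.
rewrite mulr_sumr (eq_bigr _ (fun k _ => count_fullE R k id_bij partP)).
rewrite exchange_big /= (eq_bigr (fun=> n%:R - 1)) => [|p _].
  by rewrite sumr_const card_ord -[LHS]mulr_natl; field.
rewrite exchange_big /= (eq_bigr (fun=> 1)) => [|p' p'p].
  have n_gt0 : (0 < n)%N by case: n p => // -[].
  by rewrite sumr_const cardC1 card_ord -subn1 natrB.
by rewrite (sum_in_class p p' (@inj_id 'I_n)) p'p.
Qed.

Variables (N : nat) (phi : 'I_N * T -> 'I_n).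
Hypotheses (phi_inj : injective phi) (phi_bij : bijective phi).

Definition mean_factor : R := 2 * #|edges T|%:R / ((n%:R - 1) * #|T|%:R).

Definition deviation : 'rV[R]_m :=
  count_vec R (factor phi_inj) P -
  mean_factor *: count_vec R (full (complete n)) P.

Lemma n_factor : n%:R = N%:R * #|T|%:R :> R.
Proof.
by rewrite -natrM -[in RHS](card_ord N) -card_prod (bij_eq_card phi_bij) card_ord.
Qed.

Lemma edges_eq0 : (#|T| <= 1)%N -> #|edges T| = 0%N.
Proof.
move=> T1; apply/eqP; rewrite cards_eq0; apply/eqP/setP => e; rewrite inE.
apply/negP => /card_edge e2; have := max_card (mem e).
by rewrite e2 => /leq_trans/(_ T1).
Qed.

(** The scaled counts of K_n have the same total as those of the factor, which is why the deviation
    sums to 0. *)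
Lemma mean_factor_total :
  mean_factor * (n%:R * (n%:R - 1) / 2) = N%:R * #|edges T|%:R.
Proof.
(* In the two degenerate cases both sides are 0; otherwise n > 1 and the denominator is nonzero. *)
rewrite /mean_factor; have [T1|T1] := leqP #|T| 1.
  by rewrite edges_eq0 // !(mulr0, mul0r).
have [N0|N_gt0] := posnP N; first by rewrite n_factor N0 !mul0r mulr0.
have t_neq0 : #|T|%:R != 0 :> R by rewrite pnatr_eq0 -lt0n ltnW.
have n1 : n%:R - 1 != 0 :> R.
  rewrite n_factor -natrM subr_eq0 (eqr_nat R _ 1) gtn_eqF //.
  by rewrite (leq_trans T1) // leq_pmull.
by rewrite {2}n_factor; field; rewrite n1 t_neq0.
Qed.

Lemma sum_deviation : \sum_k deviation 0 k = 0.
Proof.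
rewrite (eq_bigr (fun k => count_vec R (factor phi_inj) P 0 k -
  mean_factor * count_vec R (full (complete n)) P 0 k)) => [|k _].
  rewrite sumrB -mulr_sumr sum_count_factor // sum_count_full.
  by rewrite mean_factor_total subrr.
by rewrite !mxE.
Qed.

(** Both count vectors are nonnegative with total N q. *)
Lemma deviation_dot_le :
  dot deviation deviation <= 2 * (N%:R * #|edges T|%:R) ^+ 2.
Proof.
apply: dot_sub_le => [k|k||].
- by rewrite mxE ler0n.
- have cf_ge0 l : 0 <= count_vec R (full (complete n)) P 0 l by rewrite mxE ler0n.
  (* For n = 0 the mean factor may be negative, but all counts in K_n vanish. *)
  rewrite mxE; have [n0|n_gt0] := posnP n.
    suff -> : count_vec R (full (complete n)) P 0 k = 0 by rewrite mulr0.
    apply: (psumr_eq0P (P := xpredT)) => //.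
    by rewrite sum_count_full n0 !mul0r.
  by rewrite mulr_ge0 // /mean_factor divr_ge0 ?mulr_ge0 // subr_ge0 ler1n.
- by rewrite sum_count_factor.
- rewrite (eq_bigr _ (fun k _ => mxE _ _ _ _)) -mulr_sumr sum_count_full.
  by rewrite mean_factor_total.
Qed.
End Classes.

(** * A factor of least deviation *)

Section Descent.
Variables (R : realType) (T : graph) (n m : nat).
Variable P : 'I_m.+2 -> {set {set complete n}}.
Hypothesis partP : edge_partition P.
Variables (N : nat) (iota : T -> 'I_N) (phi0 : 'I_N * T -> 'I_n).
Hypotheses (iota_inj : injective iota) (phi0_bij : bijective phi0).
Hypotheses (q_gt0 : (0 < #|edges T|)%N) (N_gt1 : (1 < N)%N).

(** Factors are parametrized by permutations of the labels: a finite type, so a minimum exists, on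
    which moves act by composition. *)
Definition relabel_inj (tau : {perm 'I_N * T}) : injective (phi0 \o tau) :=
  inj_comp (bij_inj phi0_bij) (@perm_inj _ tau).

Local Notation count tau := (count_vec R (factor (@relabel_inj tau)) P).
Local Notation dev tau := (deviation R P (@relabel_inj tau)).
Local Notation s := (#|edges T|%:R * #|T|%:R : R).

Lemma relabel_bij (tau : {perm 'I_N * T}) : bijective (phi0 \o tau).
Proof. by apply: bij_comp => //; apply: injF_bij; apply: perm_inj. Qed.

(** The classes are pulled back along [phi0 \o tau], so that the move acts on the identity
    labelling. *)
Lemma count_move (tau : {perm 'I_N * T}) x k :
  2 * (count (move_perm iota_inj x * tau)%g 0 k - count tau 0 k) =
  move_new iota (in_class R P (phi0 \o tau) k) x -
  move_old iota (in_class R P (phi0 \o tau) k) x.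
Proof.
rewrite mulrBr !count_factorE; try exact: relabel_bij.
rewrite -(blocks_sum_move iota_inj); congr (_ - _).
apply: eq_bigr => i _; apply: eq_bigr => e _.
by rewrite /in_class /= !permM.
Qed.

Lemma card_T_gt1 : (1 < #|T|)%N.
Proof. by rewrite ltnNge; apply: contraTN q_gt0 => /edges_eq0->. Qed.

(** At most t copies with q edges each are removed or added, and each edge counts twice. *)
Lemma sum_move_le (tau : {perm 'I_N * T}) x :
  \sum_k move_new iota (in_class R P (phi0 \o tau) k) x <= 2 * s /\
  \sum_k move_old iota (in_class R P (phi0 \o tau) k) x <= 2 * s.
Proof.
have t_ge1 : 1 <= #|T|%:R :> R by rewrite ler1n ltnW ?card_T_gt1.
have sE p := @sum_edge_sum_in_class R T n _ P partP _ _ p (@relabel_inj tau).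
have le2s : 2 * #|edges T|%:R <= 2 * s by rewrite ler_pM2l // ler_peMr.
have s2E : \sum_(y : T) 2 * #|edges T|%:R = 2 * s.
  by rewrite sumr_const -mulr_natl; ring.
case: x => [[rho pi]|[i u]] /=; last first.
  by rewrite !sE // => a b [] // /perm_inj.
rewrite -s2E; split; rewrite exchange_big /=; apply: ler_sum => y _; rewrite sE // => a b []; last by [].
by move=> /perm_inj/iota_inj.
Qed.

Lemma move_new_ge0 phi k x : 0 <= move_new iota (in_class R P phi k) x.
Proof.
case: x => [[rho pi]|[i u]] /=; last exact: edge_sum_in_class_ge0.
by apply: sumr_ge0 => y _; apply: edge_sum_in_class_ge0.
Qed.

Lemma move_old_ge0 phi k x : 0 <= move_old iota (in_class R P phi k) x.
Proof.
case: x => [[rho pi]|[i u]] /=; last exact: edge_sum_in_class_ge0.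
by apply: sumr_ge0 => y _; apply: edge_sum_in_class_ge0.
Qed.

Lemma factor_near_mean : exists tau : {perm 'I_N * T},
  norm2 (dev tau) <= m.+1%:R * s ^+ 2 * Num.sqrt ((2 * s ^+ 2) ^+ m).
Proof.
have T_gt1 := card_T_gt1.
have s_ge1 : 1 <= s by rewrite -natrM ler1n muln_gt0 q_gt0 ltnW.
have [tau _ tau_min] := @arg_minP _ _ _ (1%g : {perm 'I_N * T}) xpredT
  (fun tau => dot (dev tau) (dev tau)) isT.
exists tau.
pose f k := in_class R P (phi0 \o tau) k.
pose y x := count (move_perm iota_inj x * tau)%g - count tau.
have yE x k : y x 0 k = (move_new iota (f k) x - move_old iota (f k) x) / 2.
  by rewrite /f -count_move !mxE mulrC mulKf ?pnatr_eq0.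
have devE x : dev (move_perm iota_inj x * tau)%g = dev tau + y x.
  by rewrite /deviation /y [RHS]addrC addrA subrK.
have nE : n%:R = N%:R * #|T|%:R :> R by apply: n_factor phi0_bij.
have n_gt1 : 1 < n%:R :> R.
  rewrite nE -natrM ltr1n; apply: leq_trans T_gt1 _; rewrite leq_pmull //.
  exact: ltnW.
have t_gt0 : 0 < #|T|%:R :> R by rewrite ltr0n ltnW.
have yB x : dot (y x) (y x) <= 2 * s ^+ 2.
  pose a := \row_k (move_new iota (f k) x / 2).
  pose b := \row_k (move_old iota (f k) x / 2).
  have -> : y x = a - b by apply/rowP => k; rewrite yE !mxE mulrBl.
  have [new_le old_le] := sum_move_le tau x.
  apply: dot_sub_le => [k|k||]; rewrite ?mxE.
  - by rewrite divr_ge0 // move_new_ge0.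
  - by rewrite divr_ge0 // move_old_ge0.
  - rewrite (eq_bigr _ (fun k _ => mxE _ _ _ _)) -mulr_suml.
    by rewrite ler_pdivrMr // mulrC.
  - rewrite (eq_bigr _ (fun k _ => mxE _ _ _ _)) -mulr_suml.
    by rewrite ler_pdivrMr // mulrC.
(* This is the coefficient t (t N - 1) of the factor's own count in [sum_gain]. *)
have C_gt0 : 0 < #|T|%:R * (n%:R - 1) :> R by rewrite mulr_gt0 // subr_gt0.
apply: (descent_bound (y := y) (lam := @move_weight R T N) C_gt0) => //.
- by move=> x; apply: move_weight_ge0; apply: ltnW.
- by move=> x k; rewrite !mxE rpredB // rpred_nat.
- move=> x; rewrite (eq_bigr (fun k =>
    dev (move_perm iota_inj x * tau)%g 0 k - dev tau 0 k)).
    rewrite sumrB !(sum_deviation R partP) ?subrr //; exact: relabel_bij.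
  by move=> k _; rewrite devE [X in _ = X - _]mxE addrAC subrr add0r.
(* Minimality says |d + v|^2 >= |d|^2, so 2 <v, d> >= - |v|^2 >= - 2 s^2. *)
- move=> x; have := tau_min (move_perm iota_inj x * tau)%g isT.
  rewrite devE /=; move: (yB x); move: (y x) (dev tau) => v d.
  by rewrite !dotDl !dotDr (dotC d v); lra.
apply/rowP => k; rewrite summxE.
rewrite (eq_bigr (fun x => move_weight R x *
  (move_new iota (f k) x - move_old iota (f k) x) / 2)); last first.
  by move=> x _; rewrite mxE yE mulrA.
rewrite -mulr_suml (sum_gain iota_inj) //.
have -> : blocks_sum (f k) id = 2 * count tau 0 k.
  by rewrite count_factorE //; apply: relabel_bij.
rewrite -(count_fullE R k (relabel_bij tau) partP).
have -> : (- (#|T|%:R * (n%:R - 1) *: dev tau)) 0 k = - (#|T|%:R * (n%:R - 1) *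
    (count tau 0 k - mean_factor R T n * count_vec R (full (complete n)) P 0 k)).
  by rewrite !mxE.
rewrite -[_ * N%:R]mulrC -nE /mean_factor; field.
by rewrite !gt_eqF // subr_gt0.
Qed.
End Descent.

(** * Degenerate parameters and the final constant *)

Theorem theorem2p5 (R : realType) (t q m : nat)
    (t_gt0 : (0 < t)%N) (m_gt0 : (0 < m)%N) :
  exists c : R,
    c <= (m%:R - 1) * 2 `^ ((m%:R - 2) / 2) * (q%:R * t%:R) ^+ m /\
    forall T : graph, #|T| = t -> #|edges T| = q ->
    forall n : nat, (t %| n)%N ->
    forall P : 'I_m -> {set {set complete n}}, edge_partition P ->
    exists2 H : subgraph (complete n), is_factor T H &
      let d : 'rV[R]_m :=
        count_vec R H P -
        (2 * q%:R / ((n%:R - 1) * t%:R)) *: count_vec R (full (complete n)) P in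
      `|d| <= norm2 d /\ norm2 d <= c.
Proof.
set c : R := _ * _ * _; exists c; split=> // T Tt Tq n tn P partP.
suff [phi [phi_inj dev_le]] : exists phi : 'I_(n %/ #|T|) * T -> 'I_n,
    exists phi_inj : injective phi, norm2 (deviation R P phi_inj) <= c.
  exists (factor phi_inj); first exact: factorP.
  move=> d; split; first exact: norm_le_norm2.
  have meanE : 2 * q%:R / ((n%:R - 1) * t%:R) = mean_factor R T n.
    by rewrite /mean_factor Tq Tt.
  by rewrite /d meanE.
have cardW : #|{: 'I_(n %/ #|T|) * T}| = n by rewrite card_prod card_ord Tt divnK.
pose phi0 (p : 'I_(n %/ #|T|) * T) := cast_ord cardW (enum_rank p).
have phi0_bij : bijective phi0.
  exists (fun i => enum_val (cast_ord (esym cardW) i)) => i.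
    by rewrite /phi0 cast_ordK enum_rankK.
  by rewrite /phi0 enum_valK cast_ordKV.
have phi0_inj := bij_inj phi0_bij.
(* Without edges the trivial bound makes the deviation 0, and c = 0 because m > 0. *)
have [q0|q_gt0] := posnP q.
  exists phi0, phi0_inj; rewrite norm2E.
  have -> : dot (deviation R P phi0_inj) (deviation R P phi0_inj) = 0.
    apply/eqP; rewrite eq_le dot_ge0 andbT.
    apply: le_trans (deviation_dot_le R partP phi0_inj phi0_bij) _.
    by rewrite Tq q0 mulr0 expr0n mulr0.
  by rewrite sqrtr0 /c q0 mul0r expr0n gtn_eqF ?mulr0.
have qT : (0 < #|edges T|)%N by rewrite Tq.
have t_gt1 : (1 < t)%N by rewrite -Tt card_T_gt1.
(* For a single class c = 0, and the only entry of the deviation is its sum 0. Afterwards [m] is the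
   number of classes minus two. *)
case: m m_gt0 @c P partP => // -[|m] _ c P partP.
  exists phi0, phi0_inj.
  have -> : deviation R P phi0_inj = 0.
    apply/rowP => k; rewrite [RHS]mxE -(sum_deviation R partP phi0_inj phi0_bij).
    by rewrite big_ord1 ord1.
  rewrite /norm2 big1 ?sqrtr0 => [|k _]; last by rewrite mxE expr0n.
  by rewrite /c subrr !mul0r.
set s : R := q%:R * t%:R in c *.
have s_ge2 : 2 <= s by rewrite /s -natrM (ler_nat R 2) (@leq_mul 1 2).
set X : R := 2 `^ _ in c *.
have XX : X ^+ 2 = 2 ^+ m.
  have m2 : m.+2%:R - 2 = m%:R :> R by rewrite -addn2 natrD addrK.
  rewrite -(powR_mulrn m) // -m2 /X -powR_mulrn ?powR_ge0 // -powRrM.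
  by rewrite divfK // pnatr_eq0.
have X_ge0 : 0 <= X by apply: powR_ge0.
have X_ge1 : 1 <= X.
  by rewrite -(@ler_pXn2r _ 2) ?nnegrE // expr1n XX exprn_ege1 // ler1n.
have m1 : m.+2%:R - 1 = m.+1%:R :> R by rewrite -[m.+2]addn1 natrD addrK.
(* As X^2 = 2^m, the square root is X s^m, and the claimed constant is exactly the one from the
   descent. *)
have cE : c = m.+1%:R * s ^+ 2 * Num.sqrt ((2 * s ^+ 2) ^+ m).
  have -> : (2 * s ^+ 2) ^+ m = (X * s ^+ m) ^+ 2.
    by rewrite [LHS]exprMn [RHS]exprMn XX exprAC.
  rewrite sqrtr_sqr ger0_norm ?mulr_ge0 ?exprn_ge0 //; last by apply: le_trans s_ge2.
  by rewrite /c m1 !exprS; ring.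
(* With fewer than t copies N q <= s, so |d|^2 <= 2 s^2 <= s^4 because s >= 2, and s^2 <= c. *)
have [N_small|N_big] := ltnP (n %/ #|T|) t.
  exists phi0, phi0_inj; rewrite norm2E.
  have s2_le : s ^+ 2 <= c.
    have -> : c = m.+1%:R * X * s ^+ m * s ^+ 2 by rewrite /c m1 !exprS; ring.
    have s_ge1 : 1 <= s by lra.
    apply: ler_peMl; first exact: sqr_ge0.
    apply: mulr_ege1; last exact: exprn_ege1.
    by apply: mulr_ege1; rewrite ?ler1n.
  apply: le_trans s2_le; rewrite -[leRHS]ger0_norm ?sqr_ge0 // -sqrtr_sqr.
  rewrite ler_wsqrtr //.
  apply: le_trans (deviation_dot_le R partP phi0_inj phi0_bij) _.
  have Ns : (n %/ #|T|)%:R * #|edges T|%:R <= s.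
    by rewrite Tq mulrC /s ler_wpM2l // ler_nat ltnW.
  apply: (@le_trans _ _ (2 * s ^+ 2)).
    by rewrite ler_pM2l // ler_sqr // nnegrE ?mulr_ge0 // (le_trans _ s_ge2).
  by rewrite [leRHS]expr2 ler_wpM2r ?sqr_ge0 //; nra.
(* With at least t copies, T injects into their index set and transversal moves exist. *)
pose iota (z : T) : 'I_(n %/ #|T|) := widen_ord N_big (cast_ord Tt (enum_rank z)).
have iota_inj : injective iota.
  by move=> z z' /(congr1 val) /= /val_inj/enum_rank_inj.
have [tau tau_le] :=
  factor_near_mean R partP iota_inj phi0_bij qT (leq_trans t_gt1 N_big).
exists (phi0 \o tau), (@relabel_inj _ _ _ _ phi0_bij tau).
have sE : s = #|edges T|%:R * #|T|%:R by rewrite Tq Tt.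
by rewrite cE sE.
Qed.
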